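(* Let $P=(G,v_s,V_g)$ where $G=(V,E,c,\Theta)$ is an estimated weighted digraph, $v_s\in V$ and $V_g\subset V$. The algorithm BEAUTY&BEAST (described in the context) run on $P$ is complete: it terminates, returning $(\emptyset,\infty)$ if no solution exists; and if a solution exists for $P$, it returns a tightest admissible shortest path $\pi$ together with $\mathcal{B}^*$, where in the case $U^*>L^*=0$ the returned value is $\mathcal{B}^*=\infty$.
   Context: EWDG: $G=(V,E,c,\Theta)$, with $c:E\to\mathbb{R}^+$ unobservable and $\Theta$ mapping each edge $e$ to a finite non-empty sequence of estimators $\theta_e^1,\dots,\theta_e^{k(e)}$ (each of finite running time), where $\theta_e^i$ returns $(l_e^i,u_e^i)$ with $0\le l_e^i\le c(e)\le u_e^i<\infty$ and $[l_e^j,u_e^j]\subseteq[l_e^i,u_e^i]$ for $i<j$. Tightest bounds: $l_{\Theta(e)}:=l_e^{k(e)}$, $u_{\Theta(e)}:=u_e^{k(e)}$; for a path $\pi$, $l_{\Theta(\pi)}:=\sum_{e\in\pi}l_{\Theta(e)}$, $u_{\Theta(\pi)}:=\sum_{e\in\pi}u_{\Theta(e)}$. A solution is a path from $v_s$ to a node in $V_g$. $L^*:=\min\{l_{\Theta(\pi)}\}$ and $U^*:=\min\{u_{\Theta(\pi)}\}$ over solutions $\pi$. A solution $\pi$ is $\mathcal{B}$-admissible w.r.t. $\Theta$ if $u_{\Theta(\pi)}\le L^*\cdot\mathcal{B}$; $\mathcal{B}^*:=\min_{\pi'}\{\mathcal{B}:u_{\Theta(\pi')}\le L^*\cdot\mathcal{B},\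 \pi'\text{ a solution}\}$ (taken to be $\infty$ if no finite $\mathcal{B}$ works or no solution exists); a tightest admissible shortest path is a solution achieving admissibility factor $\mathcal{B}^*$. BEAST (parameter $u_{prune}$): uniform-cost search from $v_s$ ordered by $g_u$, with $g_u(v_s)=0$; pop $n$ of minimal $g_u(n)$ from OPEN; if $n\in V_g$ return the parent-pointer path to $n$ and $g_u(n)$; else put $n$ in CLOSED and for each edge $e=(n,s)$: if $s$ is new set $g_u(s)=\infty$; set $l(e)=u(e)=0$; while $g_u(n)+l(e)<g_u(s)$, $g_u(n)+l(e)\le u_{prune}$ and estimators remain, apply the next estimator of $e$ and record its $(l(e),u(e))$; let $\tilde g=g_u(n)+u(e)$; if $\tilde g<g_u(s)$ and $\tilde g\le u_{prune}$, set $g_u(s)=\tilde g$ and (re)insert $s$ into OPEN with parent $n$. If OPEN empties return $(\emptyset,\infty)$. BEAUTY&BEAST: (1) Using an algorithm that solves SLB optimally (BEAUTY), obtain $\pi_{SLB}$ and $L^*$, where $\pi_{SLB}$ is a solution with $l_{\Theta(\pi_{SLB})}=L^*$, or $\pi_{SLB}=\emptyset$ if no solution exists; if $\pi_{SLB}=\emptyset$ return $(\emptyset,\infty)$. (2) Compute $u(\pi_{SLB}):=u_{\Theta(\pi_{SLB})}$; if $L^*=u(\pi_{SLB})$ return $(\pi_{SLB},1)$. (3) Run BEAST with $u_{prune}=u(\pi_{SLB})$, obtaining $(\pi^*,U^* )$. (4) If $L^*=0$ and $U^*>0$ return $(\pi^*,\infty)$; otherwise return $(\pi^*,U^*/L^*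 )$.
   Formalization: Admissibility factors are restricted to B ≥ 1 and the quotient U*/L* is read as 1 when both are 0, since for L*=U*=0 every real B satisfies the inequality (no minimum exists) and step (4) could require 0/0; the graph is taken finite. *)

(* Defs.v *)
From HB Require Import structures.
From mathcomp Require Import all_boot all_order all_algebra.
From mathcomp Require Import classical_sets reals constructive_ereal.
From Stdlib Require Import Relation_Operators.

Set Implicit Arguments.
Unset Strict Implicit.
Unset Printing Implicit Defensive.

Import Order.TTheory GRing.Theory Num.Theory.
Local Open Scope ring_scope.
Local Open Scope ereal_scope.

Section EstimatedGraphs.
Context (R : realType) (V : finType).

(* An estimator is represented by the pair (l, u) it returns; running it is
   one atomic operation.  [cost] and [estimators] are total functions on pairs
   of nodes, but only their values on edges are constrained or used. *)
Record ewdg := EWDG {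
  edges : {set V * V};
  cost : V * V -> R;
  estimators : V * V -> seq (R * R);
  cost_gt0 : forall e, e \in edges -> (0 < cost e)%R;
  estimators_neq0 : forall e, e \in edges -> (0 < size (estimators e))%N;
  estimators_bound : forall e th, e \in edges -> th \in estimators e ->
    (0 <= th.1 <= cost e)%R && (cost e <= th.2)%R;
  estimators_nested : forall e i j, e \in edges ->
    (i < j < size (estimators e))%N ->
    let ti := nth (0%R, 0%R) (estimators e) i in
    let tj := nth (0%R, 0%R) (estimators e) j in
    {subset `[tj.1, tj.2] <= `[ti.1, ti.2]}
}.

Record problem := Problem {
  graph :> ewdg;
  source : V;
  goals : {set V}
}.

Definition tight_bounds (G : ewdg) (e : V * V) : R * R :=
  last (0%R, 0%R) (estimators G e).

(* A path is given by its nonempty sequence of nodes; it may repeat nodes, and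
   edges are then counted with multiplicity. *)
Definition path_edges (pi : seq V) : seq (V * V) :=
  if pi is x :: p then pairmap pair x p else [::].

Definition lpath (G : ewdg) (pi : seq V) : R :=
  (\sum_(e <- path_edges pi) (tight_bounds G e).1)%R.

Definition upath (G : ewdg) (pi : seq V) : R :=
  (\sum_(e <- path_edges pi) (tight_bounds G e).2)%R.

Definition solution (P : problem) (pi : seq V) : Prop :=
  exists p : seq V,
    [/\ pi = source P :: p,
        path (fun x y => (x, y) \in edges P) (source P) p
      & last (source P) p \in goals P].

(* [is_min A m]: m is the minimum of A, and +oo if A is empty. *)
Definition is_min (A : set R) (m : \bar R) : Prop :=
  match m with
  | r%:E => A r /\ lbound A r
  | +oo => A = classical_sets.set0
  | -oo => False
  end.

Definition Lstar (P : problem) (L : \bar R) : Prop :=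
  is_min (fun x => exists2 pi, solution P pi & x = lpath P pi) L.

Definition Ustar (P : problem) (U : \bar R) : Prop :=
  is_min (fun x => exists2 pi, solution P pi & x = upath P pi) U.

Definition admissible (P : problem) (B : R) (pi : seq V) : Prop :=
  solution P pi /\ exists2 L : R, Lstar P L%:E & (upath P pi <= L * B)%R.

(* Admissibility factors range over [1, +oo[: if L* = U* = 0 then every real
   number satisfies the defining inequality, and the tightest factor is 1. *)
Definition Bstar (P : problem) (B : \bar R) : Prop :=
  is_min (fun b => (1 <= b)%R /\ exists pi, admissible P b pi) B.

(* The inequality imposes nothing for the factor +oo. *)
Definition tightest_path (P : problem) (pi : seq V) : Prop :=
  solution P pi /\
  exists2 B : \bar R, Bstar P B & forall b : R, B = b%:E -> admissible P b pi.

(* None stands for the empty answer. *)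
Definition slb_answer (P : problem) (a : option (seq V * R)) : Prop :=
  match a with
  | Some (pi, L) => [/\ solution P pi, Lstar P L%:E & lpath P pi = L]
  | None => forall pi, ~ solution P pi
  end.

Definition solves_SLB (beauty : problem -> option (seq V * R)) : Prop :=
  forall P, slb_answer P (beauty P).

Definition result : Type := (option (seq V) * \bar R)%type.

Record memory := Memory {
  opn : {set V};
  cls : {set V};
  gu : V -> \bar R;
  parent : V -> option V
}.

Inductive beast_state :=
  (* head of the main loop *)
  | Search of memory
  (* the second argument is being expanded; the last one is the set of its
     successors still to be processed *)
  | Expand of memory & V & {set V}
  (* parent pointers are followed from the given node; the nodes already met
     are accumulated in the sequence *)
  | Backtrack of memory & V & seq V & \bar R
  | BeastReturn of result.

Definition beast_init (P : problem) : beast_state :=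
  Search {| opn := [set source P];
            cls := finset.set0;
            gu := fun v => if v == source P then 0 else +oo;
            parent := fun=> None |}.

(* The inner loop on the estimators of one edge, with current bounds lu. *)
Fixpoint estimate (uprune gn gs : \bar R) (ths : seq (R * R)) (lu : R * R) :
    R * R :=
  if (gn + lu.1%:E < gs) && (gn + lu.1%:E <= uprune) then
    if ths is th :: ths' then estimate uprune gn gs ths' th else lu
  else lu.

(* Processing of the edge (n, s); s is new if it is in neither OPEN nor
   CLOSED. *)
Definition relax (P : problem) (uprune : \bar R) (m : memory) (n s : V) :
    memory :=
  let g := if s \in opn m :|: cls m then gu m
           else [eta gu m with s |-> +oo] in
  let lu := estimate uprune (g n) (g s) (estimators P (n, s)) (0%R, 0%R) in
  let gt := g n + lu.2%:E in
  if (gt < g s) && (gt <= uprune) then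
    {| opn := s |: opn m;
       cls := cls m;
       gu := [eta g with s |-> gt];
       parent := [eta parent m with s |-> Some n] |}
  else {| opn := opn m; cls := cls m; gu := g; parent := parent m |}.

Definition successors (P : problem) (n : V) : {set V} :=
  finset (fun s => (n, s) \in edges P).

(* Ties in the choice of n and the order of its successors are left open. *)
Inductive beast_step (P : problem) (uprune : \bar R) :
    beast_state -> beast_state -> Prop :=
  | step_empty m :
      opn m = finset.set0 ->
      beast_step P uprune (Search m) (BeastReturn (None, +oo))
  | step_goal m n :
      n \in opn m -> (forall v, v \in opn m -> gu m n <= gu m v) ->
      n \in goals P ->
      beast_step P uprune (Search m) (Backtrack m n [::] (gu m n))
  | step_expand m n :
      n \in opn m -> (forall v, v \in opn m -> gu m n <= gu m v) ->
      n \notin goals P ->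
      beast_step P uprune (Search m)
        (Expand {| opn := opn m :\ n; cls := n |: cls m;
                   gu := gu m; parent := parent m |}
                n (successors P n))
  | step_edge m n s (todo : {set V}) :
      s \in todo ->
      beast_step P uprune (Expand m n todo)
        (Expand (relax P uprune m n s) n (todo :\ s))
  | step_expanded m n :
      beast_step P uprune (Expand m n finset.set0) (Search m)
  | step_parent m v w acc d :
      parent m v = Some w ->
      beast_step P uprune (Backtrack m v acc d) (Backtrack m w (v :: acc) d)
  | step_root m v acc d :
      parent m v = None ->
      beast_step P uprune (Backtrack m v acc d)
        (BeastReturn (Some (v :: acc), d)).

Inductive bb_state :=
  | BBStart
  (* pi_SLB and L* are known *)
  | BBCompare of seq V & R
  (* BEAST is running, with parameter u_prune; L* is remembered *)
  | BBBeast of R & \bar R & beast_state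
  | BBReturn of result.

(* U* / L*, where 0 / 0 is read as 1 (the ratio of two equal bounds). *)
Definition ratio (U : \bar R) (L : R) : \bar R :=
  if (U == 0) && (L == 0%R) then 1 else U / L%:E.

Inductive bb_step (beauty : problem -> option (seq V * R)) (P : problem) :
    bb_state -> bb_state -> Prop :=
  | bb_nosol :
      beauty P = None ->
      bb_step beauty P BBStart (BBReturn (None, +oo))
  | bb_slb pi L :
      beauty P = Some (pi, L) ->
      bb_step beauty P BBStart (BBCompare pi L)
  | bb_equal pi L :
      L = upath P pi ->
      bb_step beauty P (BBCompare pi L) (BBReturn (Some pi, 1))
  | bb_start_beast pi L :
      L <> upath P pi ->
      bb_step beauty P (BBCompare pi L)
        (BBBeast L (upath P pi)%:E (beast_init P))
  | bb_run_beast L uprune st st' :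
      beast_step P uprune st st' ->
      bb_step beauty P (BBBeast L uprune st) (BBBeast L uprune st')
  | bb_infinite L uprune pi U :
      L = 0%R -> 0 < U ->
      bb_step beauty P (BBBeast L uprune (BeastReturn (pi, U)))
        (BBReturn (pi, +oo))
  | bb_ratio L uprune pi U :
      ~ (L = 0%R /\ 0 < U) ->
      bb_step beauty P (BBBeast L uprune (BeastReturn (pi, U)))
        (BBReturn (pi, ratio U L)).

Definition bb_reaches (beauty : problem -> option (seq V * R)) (P : problem) :
    bb_state -> Prop :=
  clos_refl_trans bb_state (bb_step beauty P) BBStart.

Definition bb_returns (beauty : problem -> option (seq V * R)) (P : problem)
    (r : result) : Prop :=
  bb_reaches beauty P (BBReturn r).

(* No execution is infinite, and an execution that cannot be continued has
   returned. *)
Definition bb_terminates (beauty : problem -> option (seq V * R))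
    (P : problem) : Prop :=
  Acc (fun st' st => bb_step beauty P st st') BBStart /\
  forall st, bb_reaches beauty P st ->
    (exists r, st = BBReturn r) \/ (exists st', bb_step beauty P st st').

End EstimatedGraphs.

(* Main.v *)
(** BEAST is Dijkstra's algorithm for the tight upper bounds.  Stopping the
    estimation of an edge early is harmless: it happens only when the current
    lower bound, hence the tight upper bound, already rules the edge out.  As
    tight upper bounds dominate positive costs, nodes are closed in
    nondecreasing order of [gu] and never reopened, and [gu] strictly decreases
    along parent pointers; this gives termination.  Pruning at [upath pi_SLB] is
    harmless too: pi_SLB survives it, so OPEN never empties and the path
    returned costs at most [upath pi_SLB], hence less than any walk whose cost
    exceeds the threshold.  With the minimal upper cost U* and the minimal lower
    cost L* the tightest factor is U* / L*. *)

Require Import Defs.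
From mathcomp Require Import all_boot all_order all_algebra.
From mathcomp Require Import classical_sets reals constructive_ereal.
From Stdlib Require Import Relation_Operators Operators_Properties.

Set Implicit Arguments.
Unset Strict Implicit.
Unset Printing Implicit Defensive.

Import Order.TTheory GRing.Theory Num.Theory.
Local Open Scope ring_scope.

(** * Bounds given by estimators, on edges and on walks *)

Section TightBounds.
Context (R : realType) (V : finType) (G : ewdg R V).
Implicit Types e : V * V.

Definition tight_upper e : R := (tight_bounds G e).2.

Lemma tight_bounds_mem e : e \in edges G -> tight_bounds G e \in estimators G e.
Proof.
move=> eG; have := estimators_neq0 eG; rewrite /tight_bounds.
by case: (estimators G e) => //= th ths _; rewrite mem_last.
Qed.

Lemma estimator_le e th : e \in edges G -> th \in estimators G e ->
  0 <= th.1 <= th.2.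
Proof.
move=> eG thG; have /andP[/andP[-> le1] le2] := estimators_bound eG thG.
exact: le_trans le2.
Qed.

Lemma tight_upper_gt0 e : e \in edges G -> 0 < tight_upper e.
Proof.
move=> eG; have /andP[_] := estimators_bound eG (tight_bounds_mem eG).
exact: lt_le_trans (cost_gt0 eG).
Qed.

(** The interval of the last estimator lies in that of [th], and it is nonempty by [estimator_le],
    so its lower end is one of the points to which nesting applies. *)
Lemma estimator_tight_lower e th : e \in edges G -> th \in estimators G e ->
  th.1 <= (tight_bounds G e).1.
Proof.
move=> eG thG; have /andP[_ tle] := estimator_le eG (tight_bounds_mem eG).
move: tle; rewrite /tight_bounds -nth_last.
have iG : (index th (estimators G e) < size (estimators G e))%N by rewrite index_mem.
rewrite -[in th.1](nth_index (0, 0) thG).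
(* Nesting is available for strictly increasing indices only, so the last estimator is treated
   apart. *)
have [ilt|ige] := ltnP (index th (estimators G e)) (size (estimators G e)).-1; last first.
  have -> : (size (estimators G e)).-1 = index th (estimators G e).
    by apply/eqP; rewrite eqn_leq ige -ltnS (ltn_predK iG).
  by rewrite lexx.
move=> tle.
have := @estimators_nested _ _ G e _ (size (estimators G e)).-1 eG.
move/(_ (index th (estimators G e))); rewrite ilt (ltn_predK iG) leqnn /=.
move/(_ isT) => /(_ (nth (0, 0) (estimators G e) (size (estimators G e)).-1).1).
by rewrite !in_itv /= lexx tle => /(_ isT) /andP[].
Qed.

Lemma upath_cons v w p : upath G [:: v, w & p] = tight_upper (v, w) + upath G (w :: p).
Proof. by rewrite /upath /= big_cons. Qed.

Lemma upath1 v : upath G [:: v] = 0.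
Proof. by rewrite /upath /= big_nil. Qed.

Lemma lpath_upath v p : path (fun x y => (x, y) \in edges G) v p ->
  0 <= lpath G (v :: p) <= upath G (v :: p).
Proof.
elim: p v => [|w p IH] v /=; first by rewrite /lpath /upath /= !big_nil lexx.
move=> /andP[eG /IH /andP[l0 lu]].
have /andP[t0 tu] := estimator_le eG (tight_bounds_mem eG).
by rewrite /lpath /upath /= !big_cons addr_ge0 //= lerD.
Qed.

End TightBounds.

Local Open Scope ereal_scope.

(** * The estimation loop on a single edge *)

Section Estimation.
Context (R : realType).
Implicit Types (gn gs up : \bar R) (ths : seq (R * R)) (lu : R * R).

Lemma estimate_stop up gn gs ths lu : let r := estimate up gn gs ths lu in
  r = last lu ths \/
  r \in lu :: ths /\ ~~ ((gn + r.1%:E < gs) && (gn + r.1%:E <= up)).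
Proof.
elim: ths lu => [|th ths IH] lu /=; first by case: ifP; left.
case: ifP => [_|/negbT lt]; last by right; rewrite mem_head lt.
have [->|[rin rn]] := IH th; first by left.
by right; split => //; rewrite in_cons rin orbT.
Qed.

(* An early stop happens only if the lower bound already excludes the edge. *)
Lemma estimate_test up gn gs ths lu (test := fun x : R => (gn + x%:E < gs) && (gn + x%:E <= up)) :
  gn \is a fin_num ->
  {in lu :: ths, forall th, th.1 <= th.2 /\ th.1 <= (last lu ths).1}%R ->
  let r := estimate up gn gs ths lu in
  test r.2 = test (last lu ths).2 /\ (test r.2 -> r = last lu ths).
Proof.
(* The test is downward closed. An early stop at [r] refutes it at [r.1], hence at [r.2] and,
   through the last lower bound, at the last upper bound. *)
move=> gnfin thsP; have testW x y : (x <= y)%R -> test y -> test x.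
  move=> xy; rewrite /test => /andP[a b].
  have le : gn + x%:E <= gn + y%:E by rewrite leeD2l ?lee_fin.
  by rewrite (le_lt_trans le a) (le_trans le b).
have [->//|] := estimate_stop up gn gs ths lu.
set r := estimate _ _ _ _ _ => -[rin nr].
have [r12 rT] := thsP _ rin.
have nr2 : test r.2 = false by apply: contraNF nr; exact: testW.
have [T12 _] := thsP _ (mem_last lu ths).
rewrite /= nr2; split=> //; apply/esym/negbTE; apply: contra nr.
by apply: testW; exact: le_trans T12.
Qed.

End Estimation.

(** * BEAST: invariants, measure and progress *)

Section Beast.
Context (R : realType) (V : finType) (P : problem R V) (up : \bar R).
Implicit Types (m : memory R V) (n s v w c : V) (todo : {set V}).

Local Notation tu := (tight_upper P).
Local Notation reached m := (opn m :|: cls m).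

(* [pend c s]: the edge from the closed node [c] to [s] is still to be relaxed. *)
Record memory_inv m (pend : rel V) : Prop := MemoryInv {
  inv_source : [/\ source P \in reached m, gu m (source P) = 0
                 & parent m (source P) = None];
  inv_ge0 v : 0 <= gu m v;
  inv_fresh v : v \notin reached m -> gu m v = +oo;
  inv_fin v : v \in reached m -> gu m v \is a fin_num;
  inv_parent v : v \in reached m -> v != source P -> exists w,
    [/\ parent m v = Some w, w \in cls m, (w, v) \in edges P
      & gu m v = gu m w + (tu (w, v))%:E];
  inv_disjoint v : v \in opn m -> v \notin cls m;
  inv_sorted c v : c \in cls m -> v \in opn m -> gu m c <= gu m v;
  inv_relaxed c s : c \in cls m -> (c, s) \in edges P -> ~~ pend c s ->
    gu m c + (tu (c, s))%:E <= up -> gu m s <= gu m c + (tu (c, s))%:E;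
  inv_goals c : c \in cls m -> c \notin goals P
}.

Definition search_inv m := memory_inv m (fun _ _ => false).

(** The value of [n] separates the closed nodes from the open ones. As edge costs are positive, no
    closed node can then be improved through [n]. *)
Record expand_inv m n todo : Prop := ExpandInv {
  expand_memory : memory_inv m (fun c s => (c == n) && (s \in todo));
  expand_closed : n \in cls m;
  expand_todo : todo \subset successors P n;
  expand_last c : c \in cls m -> gu m c <= gu m n;
  expand_first v : v \in opn m -> gu m n <= gu m v
}.

(** Processing an edge amounts to Dijkstra's relaxation with the tight upper bound: resetting a new
    node to [+oo] changes nothing by [inv_fresh], and stopping the estimators early does not alter
    the outcome. *)
Lemma relaxE m n s todo : expand_inv m n todo -> (n, s) \in edges P ->
  relax P up m n s =
  if (gu m n + (tu (n, s))%:E < gu m s) && (gu m n + (tu (n, s))%:E <= up) then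
    {| opn := s |: opn m; cls := cls m;
       gu := [eta gu m with s |-> gu m n + (tu (n, s))%:E];
       parent := [eta parent m with s |-> Some n] |}
  else m.
Proof.
move=> [mI nC _ _ _] eG; rewrite /relax.
have -> : (if s \in reached m then gu m else [eta gu m with s |-> +oo]) = gu m.
  case: ifP => // /negbT /(inv_fresh mI) sfresh.
  by apply/boolp.funext => v /=; case: eqP => // ->.
have nfin : gu m n \is a fin_num by apply: (inv_fin mI); rewrite inE nC orbT.
have [|-> ] := @estimate_test R up (gu m n) (gu m s) (estimators P (n, s)) (0, 0)%R nfin.
  (* The initial bounds (0, 0) head the list, and they too must lie below the tight lower bound. *)
  have tP := tight_bounds_mem eG; have /andP[t0 tle] := estimator_le eG tP.
  move=> th; rewrite in_cons => /predU1P[->|thG] /=; first by [].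
  by have /andP[_] := estimator_le eG thG; split=> //; exact: estimator_tight_lower.
rewrite -/(tight_bounds P (n, s)) -/(tu (n, s)).
by case: ifP => [_ /(_ isT) ->|_ _] //; case: (m).
Qed.

Lemma relax_inv m n s todo : expand_inv m n todo -> s \in todo ->
  expand_inv (relax P up m n s) n (todo :\ s).
Proof.
move=> eI sT; have [mI nC sub ela efi] := eI.
have eG : (n, s) \in edges P by have := fintype.subsetP sub _ sT; rewrite inE.
have tpos := tight_upper_gt0 eG.
have nR : n \in reached m by rewrite inE nC orbT.
have nfin := inv_fin mI nR.
have sub' : todo :\ s \subset successors P n by rewrite (fintype.subset_trans _ sub) ?finset.subD1set.
have npend c x : ~~ ((c == n) && (x \in todo :\ s)) ->
    ~~ ((c == n) && (x \in todo)) \/ c = n /\ x = s.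
  rewrite !inE; have [->|_] := eqVneq c n; last by left.
  by have [->|_] := eqVneq x s; [right|left].
have ltn : gu m n < gu m n + (tu (n, s))%:E.
  by rewrite lteDl // lte_fin.
rewrite (relaxE eI eG); case: ifP => [/andP[lt le]|nlt]; last first.
  split => //; case: mI => ? ? ? ? ? ? ? rel ?; split => // c x cC ce /npend[|[-> ->]].
    exact: rel.
  (* Within the threshold, the test can only have failed because [s] already has a value at least as
     good. *)
  by move=> le; rewrite leNgt; apply/negP => lt; rewrite lt le in nlt.
set gt := gu m n + _ in lt le ltn *.
have [sO ss sp] := inv_source mI.
(* A closed [s] would satisfy [gu m s <= gu m n < gt < gu m s]. *)
have sC : s \notin cls m by apply/negP => /ela; rewrite leNgt (lt_trans ltn).
have cs c : c \in cls m -> (c == s) = false.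
  by move=> cC; apply: contraNF sC => /eqP <-.
(* The source has value 0, which no nonnegative value improves. *)
have ssrc : (source P == s) = false.
  apply/eqP => src; move: lt; rewrite -src ss ltNge => /negP; apply.
  exact: le_trans (inv_ge0 mI n) (ltW ltn).
have gtfin : gt \is a fin_num by rewrite /gt fin_numD nfin.
have reach v : v \in reached m -> v \in (s |: opn m) :|: cls m.
  by rewrite !inE -orbA => ->; rewrite orbT.
split => //=; last first.
- move=> v; rewrite (cs _ nC) !inE; case: eqP => [_ _|_ /=]; [exact: ltW|exact: efi].
- by move=> c cC; rewrite !cs // ela.
split => //=.
- by rewrite ssrc; split=> //; exact: reach.
- by move=> v; case: ifP => _; [exact: le_trans (inv_ge0 mI n) (ltW ltn)|exact: inv_ge0 mI v].
- move=> v; rewrite !inE -orbA negb_or => /andP[/negbTE -> vR].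
  by apply: (inv_fresh mI); rewrite inE.
- move=> v; rewrite !inE -orbA; case: eqP => [_ _|_ /= vR]; first by [].
  by apply: (inv_fin mI); rewrite inE.
- move=> v; rewrite !inE -orbA; case: eqP => [-> _ _|_ /= vR vs].
    by exists n; rewrite cs.
  have [|w [pw wC we gw]] := inv_parent mI _ vs; first by rewrite inE.
  by exists w; rewrite (cs w wC).
- move=> v; rewrite !inE => /predU1P[->|]; [exact: sC|exact: (inv_disjoint mI)].
- move=> c v cC; rewrite (cs c cC) !inE; case: eqP => [_ _|_ /= vO].
    exact: le_trans (ela c cC) (ltW ltn).
  exact: (inv_sorted mI).
- move=> c x cC ce /npend; rewrite (cs c cC) => -[np|[-> ->]] lec; last by rewrite eqxx lexx.
  have := inv_relaxed mI cC ce np lec; case: eqP => [->|_] //.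
  by apply: le_trans; exact: ltW.
- exact: inv_goals mI.
Qed.

Lemma expand_search_inv m n : expand_inv m n finset.set0 -> search_inv m.
Proof.
move=> [mI _ _ _ _]; case: mI => ? ? ? ? ? ? ? rel ?; split=> // c s cC ce _.
by apply: rel; rewrite // inE andbF.
Qed.

Lemma search_expand_inv m n : search_inv m -> n \in opn m ->
  (forall v, v \in opn m -> gu m n <= gu m v) -> n \notin goals P ->
  expand_inv {| opn := opn m :\ n; cls := n |: cls m; gu := gu m; parent := parent m |}
    n (successors P n).
Proof.
move=> mI nO nmin nG; split => //=; last 2 first.
- by move=> c; rewrite !inE => /predU1P[->//|cC]; exact: (inv_sorted mI).
- by move=> v; rewrite !inE => /andP[_]; exact: nmin.
- have RE : (opn m :\ n) :|: (n |: cls m) = reached m.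
    by apply/finset.setP => v; rewrite !inE; case: eqP => [->|] //=; rewrite nO.
  split; rewrite ?RE //=.
  + exact: inv_source mI.
  + exact: inv_ge0 mI.
  + exact: inv_fresh mI.
  + exact: inv_fin mI.
  + move=> v vR vs; have [w [pw wC we gw]] := inv_parent mI vR vs.
    by exists w; rewrite !inE wC orbT.
  + by move=> v; rewrite !inE => /andP[/negbTE-> /(inv_disjoint mI)].
  + move=> c v; rewrite !inE => /predU1P[->|cC] /andP[_ vO]; first exact: nmin.
    exact: (inv_sorted mI).
  (* All edges leaving [n] are pending at first, so closing [n] adds no obligation. *)
  + move=> c s; rewrite !inE => /predU1P[->|cC] ce; first by rewrite eqxx ce.
    by move=> _; exact: (inv_relaxed mI).
  + by move=> c; rewrite !inE => /predU1P[->|/(inv_goals mI)].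
- by rewrite !inE eqxx.
Qed.

Lemma beast_init_inv m : beast_init P = Search m -> search_inv m.
Proof.
move=> [<-]; split=> //=.
- by rewrite !inE eqxx.
- by move=> v; case: ifP => // _; rewrite leey.
- by move=> v; rewrite !inE orbF => /negbTE ->.
- by move=> v; rewrite !inE orbF => ->.
- by move=> v; rewrite !inE orbF => ->.
- by move=> v _; rewrite inE.
- by move=> c v; rewrite finset.in_set0.
- by move=> c s; rewrite finset.in_set0.
- by move=> c; rewrite finset.in_set0.
Qed.

(* A walk leaves the closed nodes through OPEN, and its closed prefix has been
   relaxed edge by edge. *)
Lemma search_walk m v p C : search_inv m ->
  path (fun x y => (x, y) \in edges P) v p ->
  (C + upath P (v :: p))%R%:E <= up ->
  (v \in cls m /\ gu m v <= C%:E) \/ (exists2 x, x \in opn m & gu m x <= C%:E) ->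
  let D := (C + upath P (v :: p))%R in
  (last v p \in cls m /\ gu m (last v p) <= D%:E) \/
  (exists2 x, x \in opn m & gu m x <= D%:E).
Proof.
(* [C] is the cost of the part already walked; generalizing it lets the induction peel off the first
   edge. *)
move=> mI; elim: p v C => [|w p IH] v C; first by rewrite /= upath1 addr0.
rewrite upath_cons addrA => /andP[ve pp] le H /=; apply: IH => //.
have tpos := tight_upper_gt0 ve.
case: H => [[vC vle]|[x xO xle]]; last first.
  by right; exists x => //; rewrite (le_trans xle) // lee_fin lerDl ltW.
have le' : gu m v + (tu (v, w))%:E <= (C + tu (v, w))%R%:E by rewrite EFinD leeD2r.
have wle : gu m w <= (C + tu (v, w))%R%:E.
  apply: le_trans (le'); apply: (inv_relaxed mI) => //.
  rewrite (le_trans le') // (le_trans _ le) // lee_fin lerDl.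
  by have /andP[l0 lu] := lpath_upath pp; exact: le_trans l0 lu.
(* A finite value rules out a fresh node. *)
have : w \in reached m.
  by apply: contraTT wle => /(inv_fresh mI) ->; rewrite -ltNge ltry.
by rewrite inE => /orP[wO|wC]; [right; exists w|left].
Qed.

(** The walk starts at the source, which is open or closed with value 0, and cannot end in a closed
    node, since goals are never closed. *)
Lemma search_solution m pi : search_inv m -> solution P pi -> (upath P pi)%:E <= up ->
  exists2 x, x \in opn m & gu m x <= (upath P pi)%:E.
Proof.
move=> mI [p [-> pp pG]] le.
have [sR s0 _] := inv_source mI.
have := @search_walk m (source P) p 0 mI pp; rewrite add0r => /(_ le) [|[/(inv_goals mI)]|//].
  by move: sR; rewrite inE => /orP[sO|sC]; [right; exists (source P)|left]; rewrite ?s0.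
by rewrite pG.
Qed.

Definition shortest pi (d : \bar R) :=
  [/\ solution P pi, d = (upath P pi)%:E & forall pi', solution P pi' -> d <= (upath P pi')%:E].

(** The empty answer is excluded because a solution within the threshold is assumed wherever this
    invariant is propagated. While backtracking, [d] remains the value of the goal that was
    popped. *)
Definition beast_inv (st : beast_state R V) : Prop :=
  match st with
  | Search m => search_inv m
  | Expand m n todo => expand_inv m n todo
  | Backtrack m v acc d => [/\ search_inv m, v \in reached m,
       path (fun x y => (x, y) \in edges P) v acc, last v acc \in goals P &
       gu m v + (upath P (v :: acc))%:E = d /\
       forall pi, solution P pi -> d <= (upath P pi)%:E]
  | BeastReturn (Some pi, d) => shortest pi d
  | BeastReturn (None, _) => False
  end.

(** Closing a node frees [#|V|.+2] units, enough for its at most [#|V|] successors and the return to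
    the main loop. Backtracking is bounded by the number of nodes of smaller value. *)
Definition beast_measure (st : beast_state R V) : nat :=
  match st with
  | Search m => (#|~: cls m|.+1 * #|V|.+2)%N
  | Expand m n todo => (#|~: cls m|.+1 * #|V|.+2 + #|todo|.+1)%N
  | Backtrack m v _ _ => #|[set w | (gu m w < gu m v)%E]|.+1
  | BeastReturn _ => 0
  end.

Lemma beast_step_inv st st' : (exists2 pi, solution P pi & (upath P pi)%:E <= up) ->
  beast_inv st -> beast_step P up st st' -> beast_inv st'.
Proof.
move=> [pi0 sol0 le0] stI step; case: step stI => {st st'} /=.
- by move=> m O0 mI; have [x] := search_solution mI sol0 le0; rewrite O0 inE.
- move=> m n nO nmin nG mI; split=> //; first by rewrite inE nO.
  split=> [|pi sol]; first by rewrite upath1 adde0.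
  have [/(search_solution mI sol) [x xO]|] := leP (upath P pi)%:E up.
    by apply: le_trans; exact: nmin.
  (* A solution above the threshold costs more than [pi0], whose cost bounds the popped value. *)
  have [x xO xle] := search_solution mI sol0 le0.
  by move=> /ltW; apply: le_trans; rewrite (le_trans (nmin _ xO)) // (le_trans xle).
- by move=> m n nO nmin nG mI; exact: search_expand_inv.
- by move=> m n s todo sT eI; exact: relax_inv.
- by move=> m n; exact: expand_search_inv.
- move=> m v w acc d pw [mI vR pp pG [gE dmin]].
  have [vs|vs] := eqVneq v (source P).
    by have [_ _] := inv_source mI; rewrite -vs pw.
  have [w' [+ wC we gw]] := inv_parent mI vR vs; rewrite pw => -[?]; subst w'.
  split=> //=; rewrite ?we ?inE ?wC ?orbT //.
  by rewrite upath_cons EFinD addeA -gw.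
- move=> m v acc d pv [mI vR pp pG [gE dmin]].
  have [vs|vs] := eqVneq v (source P); last first.
    by have [w'] := inv_parent mI vR vs; rewrite pv => -[].
  have [_ s0 _] := inv_source mI.
  split=> //; first by exists acc; rewrite -vs.
  by rewrite -gE vs s0 add0e.
Qed.

Lemma beast_step_measure st st' : beast_inv st -> beast_step P up st st' ->
  (beast_measure st' < beast_measure st)%N.
Proof.
move=> stI step; case: step stI => {st st'} /=.
- by move=> m _ _; rewrite muln_gt0.
- move=> m n nO nmin nG _; rewrite mulSn ltn_addr // !ltnS (leq_trans (max_card _)) //.
- move=> m n nO nmin nG mI.
  have <- : (#|~: (n |: cls m)|.+1 = #|~: cls m|)%N.
    rewrite [RHS](cardsD1 n) !inE (inv_disjoint mI nO) add1n; congr _.+1.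
    by apply: eq_card => v; rewrite !inE negb_or.
  rewrite [ltnRHS]mulSn addnC ltn_add2r ltnS.
  exact: leq_trans (max_card _) _.
- move=> m n s todo sT eI.
  have sE : (n, s) \in edges P by have := fintype.subsetP (expand_todo eI) _ sT; rewrite inE.
  have -> : cls (relax P up m n s) = cls m by rewrite (relaxE eI sE); case: ifP.
  by rewrite ltn_add2l ltnS (cardsD1 s todo) sT.
- by move=> m n _; rewrite addnS ltnS leq_addr.
- move=> m v w acc d pw [mI vR _ _ _].
  have [vs|vs] := eqVneq v (source P).
    by have [_ _] := inv_source mI; rewrite -vs pw.
  have [w' [+ wC we gw]] := inv_parent mI vR vs; rewrite pw => -[?]; subst w'.
  have wlt : gu m w < gu m v.
    rewrite gw lteDl ?lte_fin ?tight_upper_gt0 //.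
    by apply: (inv_fin mI); rewrite inE wC orbT.
  rewrite ltnS; apply: proper_card; apply/fintype.properP; split.
    by apply/fintype.subsetP => x; rewrite !inE => /lt_trans; apply.
  by exists w; rewrite !inE ?ltxx.
- by [].
Qed.

Lemma beast_progress st : (exists r, st = BeastReturn r) \/ exists st', beast_step P up st st'.
Proof.
case: st => [m|m n todo|m v acc d|r]; last by left; exists r.
- right; have [O0|[x xO]] := finset.set_0Vmem (opn m); first by eexists; exact: step_empty.
  pose n := [arg min_(i < x in opn m) gu m i]%O.
  have [nO nmin] : n \in opn m /\ forall v, v \in opn m -> gu m n <= gu m v.
    by rewrite /n; case: arg_minP.
  have [nG|nG] := boolP (n \in goals P); first by eexists; exact: (step_goal _ nO).
  by eexists; exact: (step_expand _ nO).
- right; have [->|[s sT]] := finset.set_0Vmem todo; first by eexists; exact: step_expanded.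
  by eexists; exact: step_edge sT.
- right; case pv: (parent m v) => [w|]; first by eexists; exact: step_parent pv.
  by eexists; exact: step_root.
Qed.

End Beast.

(** * Correctness and termination of the combined algorithm *)

Section BeautyAndBeast.
Context (R : realType) (V : finType) (P : problem R V).
Context (beauty : problem R V -> option (seq V * R)).
Context (beauty_optimal : solves_SLB beauty).

Lemma is_min_unique (A : set R) (x y : \bar R) : is_min A x -> is_min A y -> x = y.
Proof.
case: x y => [x| |] [y| |] //=.
- by move=> [Ax lx] [Ay ly]; congr _%:E; apply/eqP; rewrite eq_le lx // ly.
- by move=> [Ax _] A0; rewrite A0 in Ax.
- by move=> A0 [Ay _]; rewrite A0 in Ay.
Qed.

Definition answer_correct (r : result R V) : Prop :=
  exists (pi : seq V) (B : \bar R),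
    [/\ r = (Some pi, B), tightest_path P pi, Bstar P B
      & forall L U : R, Lstar P L%:E -> Ustar P U%:E ->
          L = 0%R -> (0 < U)%R -> B = +oo].

Definition bb_correct (r : result R V) : Prop :=
  ((~ exists pi, solution P pi) -> r = (None, +oo)) /\
  ((exists pi, solution P pi) -> answer_correct r).

Lemma answer_correct_bb r : (exists pi, solution P pi) -> answer_correct r -> bb_correct r.
Proof. by move=> sol rP; split. Qed.

Lemma Lstar_ge0 L : Lstar P L%:E -> (0 <= L)%R.
Proof.
by move=> [[_ [p [-> pp _]] ->] _]; have /andP[] := lpath_upath pp.
Qed.

(** Factor 1 is attained and is the least one allowed. The case U* > L* = 0 cannot occur, as U* is
    at most the upper cost of [pi], which is L*. *)
Lemma tight_slb_correct pi L : slb_answer P (Some (pi, L)) -> L = upath P pi ->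
  answer_correct (Some pi, 1).
Proof.
move=> [sol LP _] Lu; have adm : admissible P 1 pi.
  by split=> //; exists L; rewrite // mulr1 Lu.
have BP : Bstar P 1 by split=> [|b []//]; split=> //; exists pi.
exists pi, 1; split=> //.
  by split=> //; exists 1 => // b [<-].
move=> L' U L'P [_ Ulb] L'0 U0.
have [LL'] := is_min_unique LP L'P.
have := Ulb _ (ex_intro2 _ _ pi sol erefl).
by rewrite -Lu LL' L'0 leNgt U0.
Qed.

(** With L* = 0, admissibility for any real factor would force a nonpositive upper cost, but every
    solution costs at least [U]. *)
Lemma beast_infinite_correct L pi U : Lstar P L%:E -> shortest P pi U ->
  L = 0%R -> 0 < U -> answer_correct (Some pi, +oo).
Proof.
move=> LP [sol UE Umin] L0 U0; have BP : Bstar P +oo.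
  apply/seteqP; split=> // b [_ [pi' [sol' [L' L'P]]]].
  have [<-] := is_min_unique LP L'P; rewrite L0 mul0r leNgt -lte_fin.
  by rewrite (lt_le_trans U0 (Umin _ sol')).
by exists pi, +oo; split=> //; split=> //; exists +oo.
Qed.

(** If a solution [pi'] is admissible for [b'], then [U <= upath P pi' <= L * b'], so for [L]
    nonzero [b'] is at least the ratio. If [L] is 0, so is [U], and 1 is the least factor
    allowed. *)
Lemma beast_ratio_correct L pi U : Lstar P L%:E -> shortest P pi U ->
  ~ (L = 0%R /\ 0 < U) -> answer_correct (Some pi, Defs.ratio U L).
Proof.
move=> LP [sol UE Umin] nLU; have L0 := Lstar_ge0 LP.
set u := upath P pi in UE.
have Lu : (L <= u)%R.
  case: LP => _ lb; apply: le_trans (lb _ (ex_intro2 _ _ pi sol erefl)) _.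
  by case: sol => p [piE pp _]; rewrite /u piE; have /andP[] := lpath_upath pp.
have u0 : L = 0%R -> u = 0%R.
  move=> LE; apply/eqP; rewrite eq_le (le_trans L0 Lu) andbT leNgt.
  by apply/negP => u0; apply: nLU; rewrite UE lte_fin.
(* The real value of the ratio; reading 0 / 0 as 1 keeps both [u = L * b] and [1 <= b]. *)
pose b := (if L == 0 then 1 else u / L)%R.
have -> : Defs.ratio U L = b%:E.
  rewrite /Defs.ratio UE eqe /b; have [LE|LE] := eqVneq L 0%R; first by rewrite u0 ?eqxx.
  by rewrite andbF inver (negbTE LE) -EFinM.
have ub : u = (L * b)%R.
  by rewrite /b; case: eqVneq => [LE|LE]; [rewrite u0 // LE mul0r|rewrite mulrC divfK].
have b1 : (1 <= b)%R.
  by rewrite /b; case: eqVneq => [//|LE]; rewrite ler_pdivlMr ?mul1r // lt_neqAle eq_sym LE.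
have adm : admissible P b pi by split=> //; exists L; rewrite // -ub.
have BP : Bstar P b%:E.
  split=> [|b' [b'1 [pi' [sol' [L' L'P]]]]]; first by split=> //; exists pi.
  have [<-] := is_min_unique LP L'P => le; rewrite /b; case: eqVneq => [//|LE].
  rewrite ler_pdivrMr ?lt_neqAle 1?eq_sym ?LE // mulrC (le_trans _ le) //.
  by rewrite -lee_fin -UE Umin.
exists pi, b%:E; split=> //.
  by split=> //; exists b%:E => // b' [<-].
move=> L' U' L'P [[pi' sol' ->] Ulb] L'0 U'0.
have [LL'] := is_min_unique LP L'P.
have := Ulb _ (ex_intro2 _ _ pi sol erefl).
by rewrite leNgt -/u u0 ?LL' // U'0.
Qed.

(** During BEAST, the solution within the threshold is initially supplied by the SLB answer, whose
    upper cost is the threshold itself. *)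
Definition bb_inv (st : bb_state R V) : Prop :=
  match st with
  | BBStart => True
  | BBCompare pi L => slb_answer P (Some (pi, L))
  | BBBeast L up bst => Lstar P L%:E /\
      (exists2 pi, solution P pi & (upath P pi)%:E <= up) /\ beast_inv P up bst
  | BBReturn r => bb_correct r
  end.

Definition bb_measure (st : bb_state R V) : nat :=
  match st with
  | BBStart => (beast_measure (beast_init P)).+3
  | BBCompare _ _ => (beast_measure (beast_init P)).+2
  | BBBeast _ _ bst => (beast_measure bst).+1
  | BBReturn _ => 0
  end.

Lemma bb_step_inv st st' : bb_inv st -> bb_step beauty P st st' ->
  bb_inv st' /\ (bb_measure st' < bb_measure st)%N.
Proof.
move=> stI step; case: step stI => {st st'}.
- move=> bN _; have := beauty_optimal P; rewrite bN /= => nsol.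
  by split=> //; split=> // -[pi /nsol].
- by move=> pi L bS _; have := beauty_optimal P; rewrite bS.
- move=> pi L LE slb; split=> //; apply: answer_correct_bb; last exact: tight_slb_correct LE.
  by case: slb => sol _ _; exists pi.
- move=> pi L _ [sol LP _]; split=> //; split=> //; split; first by exists pi.
  exact: beast_init_inv.
- move=> L up st st' step [LP [sol stI]]; split.
    by split=> //; split=> //; exact: beast_step_inv step.
  exact: beast_step_measure step.
- move=> L up [pi|] U L0 U0 [LP [[pi0 sol0 _] //= sh]]; split=> //.
  apply: answer_correct_bb; first by exists pi0.
  exact: beast_infinite_correct sh L0 U0.
- move=> L up [pi|] U nLU [LP [[pi0 sol0 _] //= sh]]; split=> //.
  apply: answer_correct_bb; first by exists pi0.
  exact: beast_ratio_correct.
Qed.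

Lemma bb_reaches_inv st : bb_reaches beauty P st -> bb_inv st.
Proof.
(* Steps are appended at the end of the execution, so that the invariant propagates forward. *)
rewrite /bb_reaches => /clos_rt_rtn1_iff; elim=> // st1 st2 step _ stI.
by have [] := bb_step_inv stI step.
Qed.

Lemma bb_inv_Acc st : bb_inv st -> Acc (fun st' st => bb_step beauty P st st') st.
Proof.
have [k] := ubnP (bb_measure st).
elim: k st => [st|k IH st]; first by rewrite ltn0.
rewrite ltnS => lek stI.
constructor=> st' step; have [stI' lt] := bb_step_inv stI step.
exact: (IH st' (leq_trans lt lek) stI').
Qed.

Lemma bb_progress st : (exists r, st = BBReturn r) \/ exists st', bb_step beauty P st st'.
Proof.
case: st => [|pi L|L up bst|r]; last by left; exists r.
- right; case bE: (beauty P) => [[pi L]|]; first by eexists; exact: bb_slb bE.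
  by eexists; exact: bb_nosol.
- right; have [LE|/eqP LE] := eqVneq L (upath P pi); first by eexists; exact: bb_equal.
  by eexists; exact: bb_start_beast.
- right; have [[[pi U] ->]|[bst' step]] := beast_progress P up bst; last first.
    by eexists; exact: bb_run_beast step.
  have [/andP[/eqP L0 U0]|nLU] := boolP ((L == 0%R) && (0 < U)).
    by eexists; exact: bb_infinite.
  by eexists; apply: bb_ratio => -[L0 U0]; rewrite L0 eqxx U0 in nLU.
Qed.

End BeautyAndBeast.

Theorem theorem5 (R : realType) (V : finType) (P : problem R V)
    (beauty : problem R V -> option (seq V * R))
    (beauty_optimal : solves_SLB beauty) :
  bb_terminates beauty P /\
  forall r : result R V, bb_returns beauty P r ->
    ((~ exists pi, solution P pi) -> r = (None, +oo%E)) /\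
    ((exists pi, solution P pi) ->
      exists (pi : seq V) (B : \bar R),
        [/\ r = (Some pi, B), tightest_path P pi, Bstar P B
          & forall L U : R, Lstar P L%:E -> Ustar P U%:E ->
              L = 0%R -> (0 < U)%R -> B = +oo%E]).
Proof.
split; last by move=> r /(bb_reaches_inv beauty_optimal).
split; first exact: bb_inv_Acc.
by move=> st _; exact: bb_progress.
Qed.
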